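(* Let $\mathscr{C}\in\mathscr{S}$, $n\ge 1$, and let $x=\mathrm{D}(n,i,j,l_r,\alpha_r,f)$ and $y=\mathrm{D}(n,j,k,m_r,\beta_r,g)$ be two morphisms in $\mathscr{P}^n(\mathscr{C})$. Then the product $yx$ (first $x$, then $y$) in $\mathscr{P}^n(\mathscr{C})$ is the element $\mathrm{D}(n,i,k,n_r,\gamma_r,h)$ obtained in $\mathscr{C}$ as follows. Put $m_{n+1}=j$, $p_{n+1}^{s}=l_s$ for $1\le s\le n$, $p_{n+1}^{n+1}=i$, $f^{(n+1)}=f:l_1\to j$ and $\alpha_s^{(n+1)}=\alpha_s:p_{n+1}^s\to p_{n+1}^{s+1}$ for $1\le s\le n$. For $r=n,n-1,\dots,1$ successively: (1) $\beta_r^{(1)}:p_r^1\to p_{r+1}^1$ and $f^{(r)}:p_r^1\to m_r$ form a pullback of $f^{(r+1)}:p_{r+1}^1\to m_{r+1}$ along $\beta_r:m_r\to m_{r+1}$; (2) for $s=1,\dots,r-1$ successively, the object $p_r^{s+1}$ and the monomorphisms $\alpha_s^{(r)}:p_r^s\to p_r^{s+1}$ and $\beta_r^{(s+1)}:p_r^{s+1}\to p_{r+1}^{s+1}$ complete $p_r^s\xrightarrow{\beta_r^{(s)}}p_{r+1}^s\xrightarrow{\alpha_s^{(r+1)}}p_{r+1}^{s+1}$ to a complement diagram. Then $n_r=p_r^r$ for $1\le r\le n$, $\gamma_r=\alpha_r^{(r+1)}\beta_r^{(r)}:n_r\to n_{r+1}$ for $1\le r\le n$ (with $n_{n+1}=i$),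 and $h=g f^{(1)}:n_1\to k$.
   Context: Condition (PB) on a category $\mathscr{C}$: for any objects $i,j,k$, any $f\in\mathscr{C}(i,j)$ and any monomorphism $\alpha\in\mathscr{C}(k,j)$ there exists a pullback of $f$ along $\alpha$. Condition (CD) on a category $\mathscr{C}$: for all objects $i,j,k$ and monomorphisms $\alpha\in\mathscr{C}(i,j)$, $\beta\in\mathscr{C}(j,k)$ there exist an object $l$ and monomorphisms $\gamma\in\mathscr{C}(i,l)$, $\delta\in\mathscr{C}(l,k)$ such that: (a) the square $\beta\alpha=\delta\gamma$ is a pullback (of $\beta$ and $\delta$); (b) for all objects $m,n$ and monomorphisms $\xi\in\mathscr{C}(m,i)$, $\eta\in\mathscr{C}(m,n)$, $\zeta\in\mathscr{C}(n,k)$ such that $\zeta\eta=\beta\alpha\xi$ and this square (with $\zeta$, $\eta$, $\beta$ and $\alpha\xi$) is a pullback, there exists $\varphi\in\mathscr{C}(n,l)$ with $\delta\varphi=\zeta$ and $\varphi\eta=\gamma\xi$. The square formed by such $\alpha,\beta,\gamma,\delta$ is called the complement diagram (of $i\xrightarrow{\alpha}j\xrightarrow{\beta}k$); $l,\gamma,\delta$ are unique up to isomorphism. $\mathscr{S}$ is the category whose objects are small categories satisfying (PB) and (CD), and whose morphisms are all functors which preserve monomorphisms. The partialization $\mathscr{P}(\mathscr{C})$: same objects as $\mathscr{C}$; a morphism from $i$ to $j$ is an equivalence class of diagrams $\mathrm{D}(i,j,k,\alpha,f)$: $i\xleftarrow{\alpha}k\xrightarrow{f}j$ with $\alpha$ a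 monomorphism, $(k,\alpha,f)$ and $(k',\alpha',f')$ being equivalent if there is an isomorphism $\gamma:k\to k'$ with $\alpha'\gamma=\alpha$, $f'\gamma=f$. The composition of $i\xleftarrow{\alpha}k\xrightarrow{f}j$ (first) with $j\xleftarrow{\beta}n\xrightarrow{g}m$ (second) is $i\xleftarrow{\alpha\gamma}l\xrightarrow{gh}m$, where $\gamma:l\to k$, $h:l\to n$ is the pullback of $f$ along $\beta$. The paper establishes that $\mathscr{P}$ is an endofunctor of $\mathscr{S}$, so $\mathscr{P}^n(\mathscr{C})$ (the $n$-fold iteration) is defined. The monomorphisms of $\mathscr{P}(\mathscr{C})$ are exactly the images of monomorphisms $\gamma:i\to j$ of $\mathscr{C}$ under $\gamma\mapsto\mathrm{D}(i,j,i,\mathtt{1}_i,\gamma)$ and are identified with them. Hence the morphisms of $\mathscr{P}^n(\mathscr{C})$ from $i$ to $j$ are identified with equivalence classes of diagrams $\mathrm{D}(n,i,j,k_r,\alpha_r,f)$: $i\xleftarrow{\alpha_n}k_n\xleftarrow{\alpha_{n-1}}\cdots\xleftarrow{\alpha_1}k_1\xrightarrow{f}j$ in $\mathscr{C}$, with all $\alpha_r$ monomorphisms (the diagram stands for $i\xleftarrow{\alpha_n}k_n\to j$ where $k_n\to j$ is the morphism of $\mathscr{P}^{n-1}(\mathscr{C})$ given by the rest of the diagram); two diagrams are equivalent if there are isomorphisms $\gamma_r:k_r\to k_r'$ with $\alpha'_n\gamma_n=\alpha_n$, $\alpha'_r\gamma_r=\gamma_{r+1}\alpha_r$ for $r<n$,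 and $f'\gamma_1=f$.
   Formalization: The statement assumes that P^n(C) is defined, i.e. (PB) holds for P^r(C) for all r < n; with (CD) as given (ζ restricted to monomorphisms) this does not follow from C being in S when n ≥ 2. *)

(* Defs.v *)
From mathcomp Require Import all_boot.
From mathcomp Require Import boolp.

Set Implicit Arguments.
Unset Strict Implicit.
Unset Printing Implicit Defensive.

Local Open Scope quotient_scope.

(* The set of objects is a parameter, so that a category and its
   partialization literally have the same objects. *)
Record category (Ob : Type) : Type := Category {
  hom : Ob -> Ob -> Type;
  idm : forall i, hom i i;
  comp : forall i j k, hom j k -> hom i j -> hom i k;
  comp_idl : forall i j (f : hom i j), comp (idm j) f = f;
  comp_idr : forall i j (f : hom i j), comp f (idm i) = f;
  comp_assoc : forall i j k l (h : hom k l) (g : hom j k) (f : hom i j),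
    comp h (comp g f) = comp (comp h g) f
}.

Arguments idm {Ob} c i.
Arguments comp {Ob} c {i j k} g f.

Declare Scope cat_scope.
Delimit Scope cat_scope with cat.
Notation "g ∘ f" := (comp _ g f)
  (at level 40, left associativity) : cat_scope.
Local Open Scope cat_scope.

Section CategoryNotions.
Variables (Ob : Type) (C : category Ob).
Local Notation Hom := (hom C).

Definition is_mono i j (a : Hom i j) : Prop :=
  forall t (u v : Hom t i), a ∘ u = a ∘ v -> u = v.

Record mono (i j : Ob) : Type := Mono {
  mono_hom :> Hom i j;
  mono_homP : is_mono mono_hom
}.

Definition is_iso i j (u : Hom i j) : Prop :=
  exists v : Hom j i, v ∘ u = idm C i /\ u ∘ v = idm C j.

(* b : p -> i and g : p -> k form a pullback of f : i -> j along a : k -> j. *)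
Definition is_pullback i j k p
    (f : Hom i j) (a : Hom k j) (b : Hom p i) (g : Hom p k) : Prop :=
  f ∘ b = a ∘ g /\
  forall t (u : Hom t i) (v : Hom t k), f ∘ u = a ∘ v ->
    exists! w : Hom t p, b ∘ w = u /\ g ∘ w = v.

Definition condPB : Prop :=
  forall i j k (f : Hom i j) (a : mono k j),
    exists p (b : Hom p i) (g : Hom p k), is_pullback f a b g.

(* l, c, d complete i -a-> j -b-> k to a complement diagram. *)
Definition is_complement i j k l
    (a : mono i j) (b : mono j k) (c : mono i l) (d : mono l k) : Prop :=
  is_pullback b d a c /\
  forall m n (xi : mono m i) (eta : mono m n) (zeta : mono n k),
    is_pullback zeta b eta (a ∘ xi) ->
    exists phi : Hom n l, d ∘ phi = zeta /\ phi ∘ eta = c ∘ xi.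

Definition condCD : Prop :=
  forall i j k (a : mono i j) (b : mono j k),
    exists l (c : mono i l) (d : mono l k), is_complement a b c d.

Definition inS : Prop := condPB /\ condCD.

Lemma is_mono_id i : is_mono (idm C i).
Proof. by move=> t u v; rewrite !comp_idl. Qed.

Lemma is_mono_comp i j k (b : mono j k) (a : mono i j) : is_mono (b ∘ a).
Proof.
move=> t u v; rewrite -!comp_assoc => /(@mono_homP _ _ b).
exact: mono_homP.
Qed.

Definition mono_id i : mono i i := Mono (@is_mono_id i).
Definition mono_comp i j k (b : mono j k) (a : mono i j) : mono i k :=
  Mono (is_mono_comp (b := b) (a := a)).

Lemma pullback_mono i j k p (f : Hom i j) (a : mono k j)
  (b : Hom p i) (g : Hom p k) : is_pullback f a b g -> is_mono b.
Proof.
move=> [fb pb] t u v buv.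
have guv : g ∘ u = g ∘ v.
  by apply: (mono_homP (m := a)); rewrite !comp_assoc -fb -!comp_assoc buv.
have fbu : f ∘ (b ∘ v) = a ∘ (g ∘ v) by rewrite !comp_assoc fb.
have [w [_ w_uniq]] := pb t _ _ fbu.
by rewrite -(w_uniq u) // -(w_uniq v).
Qed.

(* Along a monomorphism, uniqueness in the universal property is automatic. *)
Lemma pullback_intro i j k p (f : Hom i j) (a : mono k j)
    (b : mono p i) (g : Hom p k) :
  f ∘ b = a ∘ g ->
  (forall t (u : Hom t i) (v : Hom t k), f ∘ u = a ∘ v ->
    exists w : Hom t p, b ∘ w = u /\ g ∘ w = v) ->
  is_pullback f a b g.
Proof.
move=> fb ex; split=> // t u v /ex[w [bw gw]]; exists w; split=> // w' [bw' _].
by apply: (mono_homP (m := b)); rewrite bw bw'.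
Qed.

Lemma mono_pullback_ex (pb : condPB) i j k (f : Hom i j) (a : mono k j) :
  exists p (b : mono p i) (g : Hom p k), is_pullback f a b g.
Proof.
have [p [b [g bg]]] := pb _ _ _ f a.
by exists p, (Mono (pullback_mono bg)), g.
Qed.

(* A diagram i <-leg- apex -arr-> j. *)
Record span (i j : Ob) : Type := Span {
  apex : Ob;
  leg : mono apex i;
  arr : Hom apex j
}.

Definition span_iso i j (s t : span i j) : Prop :=
  exists u : Hom (apex s) (apex t),
    is_iso u /\ leg t ∘ u = leg s /\ arr t ∘ u = arr s.

Lemma span_iso_refl i j (s : span i j) : span_iso s s.
Proof.
exists (idm C _); split; last by rewrite !comp_idr.
by exists (idm C _); rewrite comp_idl.
Qed.

Lemma span_iso_sym i j (s t : span i j) : span_iso s t -> span_iso t s.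
Proof.
move=> [u [[v [vu uv]] [lu au]]]; exists v; split; first by exists u.
by rewrite -lu -au -!comp_assoc uv !comp_idr.
Qed.

Lemma span_iso_trans i j (s t r : span i j) :
  span_iso s t -> span_iso t r -> span_iso s r.
Proof.
move=> [u [[v [vu uv]] [lu au]]] [u' [[v' [vu' uv']] [lu' au']]].
exists (u' ∘ u); split; last by rewrite !comp_assoc lu' au'.
exists (v ∘ v'); split.
  by rewrite comp_assoc -(comp_assoc v) vu' comp_idr.
by rewrite comp_assoc -(comp_assoc u') uv comp_idr.
Qed.

Definition span_eqb i j : rel {classic span i j} := fun s t => `[< span_iso s t >].

Lemma span_eqb_equiv i j : equiv_class_of (@span_eqb i j).
Proof.
split=> [s|s t|t s r].
- exact/asboolP/span_iso_refl.
- by apply/asboolP/asboolP; apply: span_iso_sym.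
- by move=> /asboolP st /asboolP tr; apply/asboolP/(span_iso_trans st).
Qed.

Canonical span_equiv i j := EquivRelPack (@span_eqb_equiv i j).

Definition phom (i j : Ob) : Type := {eq_quot @span_equiv i j}.

Definition pclass i j (s : span i j) : phom i j :=
  \pi_({eq_quot @span_equiv i j}) (s : {classic span i j}).

Lemma pclassP i j (s t : span i j) : pclass s = pclass t <-> span_iso s t.
Proof.
split; first by move=> /eqmodP/asboolP.
by move=> st; apply/eqmodP/asboolP.
Qed.

Lemma pclass_ex i j (x : phom i j) : exists s, x = pclass s.
Proof. by exists (repr x); rewrite /pclass reprK. Qed.

(* b, g: a pullback of arr s along leg t. *)
Definition span_comp i j k (s : span i j) (t : span j k) p
    (b : mono p (apex s)) (g : Hom p (apex t)) : span i k :=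
  Span (mono_comp (leg s) b) (arr t ∘ g).

Lemma span_comp_iso i j k (s s' : span i j) (t t' : span j k) p p'
    (b : mono p (apex s)) (g : Hom p (apex t))
    (b' : mono p' (apex s')) (g' : Hom p' (apex t')) :
  span_iso s s' -> span_iso t t' ->
  is_pullback (arr s) (leg t) b g -> is_pullback (arr s') (leg t') b' g' ->
  span_iso (span_comp b g) (span_comp b' g').
Proof.
move=> [u [[u' [u'u uu']] [lu au]]] [v [[v' [v'v vv']] [lv av]]].
move=> [sq pb] [sq' pb'].
have lu' : leg s ∘ u' = leg s' by rewrite -lu -comp_assoc uu' comp_idr.
have au' : arr s ∘ u' = arr s' by rewrite -au -comp_assoc uu' comp_idr.
have lv' : leg t ∘ v' = leg t' by rewrite -lv -comp_assoc vv' comp_idr.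
have [|w [[bw gw] _]] := pb' p (u ∘ b) (v ∘ g).
  by rewrite !comp_assoc au lv.
have [|w' [[bw' gw'] _]] := pb p' (u' ∘ b') (v' ∘ g').
  by rewrite !comp_assoc au' lv'.
exists w; split; last first.
  rewrite /= -!comp_assoc bw gw; split; first by rewrite comp_assoc lu.
  by rewrite comp_assoc av.
exists w'; split.
  apply: (mono_homP (m := b)).
  by rewrite comp_assoc bw' -comp_assoc bw comp_assoc u'u comp_idl comp_idr.
apply: (mono_homP (m := b')).
by rewrite comp_assoc bw -comp_assoc bw' comp_assoc uu' comp_idl comp_idr.
Qed.

Section Partialization.
Hypothesis pb : condPB.

Definition chosen_pullback i j k (s : span i j) (t : span j k) :
    {p : Ob & {b : mono p (apex s) & {g : Hom p (apex t) |
      is_pullback (arr s) (leg t) b g}}}.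
Proof.
have [p /cid[b /cid[g bg]]] := cid (mono_pullback_ex pb (arr s) (leg t)).
by exists p, b, g.
Defined.

(* Composition is computed on chosen representatives and a chosen pullback;
   by pcompE below, the result does not depend on these choices. *)
Definition pcomp i j k (y : phom j k) (x : phom i j) : phom i k :=
  let: existT _ (existT b (exist g _)) :=
    chosen_pullback (repr x : span i j) (repr y : span j k) in
  pclass (span_comp b g).

Lemma pcompE i j k (s : span i j) (t : span j k) p
    (b : mono p (apex s)) (g : Hom p (apex t)) :
  is_pullback (arr s) (leg t) b g ->
  pcomp (pclass t) (pclass s) = pclass (span_comp b g).
Proof.
move=> bg; rewrite /pcomp; case: chosen_pullback => p' [b' [g' bg']].
apply/pclassP; apply: span_comp_iso bg' bg; apply/pclassP; exact: reprK.
Qed.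

Definition ispan i j (f : Hom i j) : span i j := Span (mono_id i) f.

Definition pid i : phom i i := pclass (ispan (idm C i)).

Lemma pcomp_idl i j (x : phom i j) : pcomp (pid j) x = x.
Proof.
have [s ->] := pclass_ex x.
rewrite /pid (@pcompE _ _ _ s (ispan _) _ (mono_id _) (arr s)); last first.
  apply: pullback_intro => /=; first by rewrite comp_idl comp_idr.
  by move=> t u v; rewrite comp_idl => <-; exists u; rewrite comp_idl.
apply/pclassP; exists (idm C _); split; first by exists (idm C _); rewrite comp_idl.
by rewrite /= !comp_idl !comp_idr.
Qed.

Lemma pcomp_ispan i j k (s : span j k) (f : Hom i j) p
    (b : mono p i) (g : Hom p (apex s)) :
  is_pullback f (leg s) b g ->
  pcomp (pclass s) (pclass (ispan f)) = pclass (Span b (arr s ∘ g)).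
Proof.
move=> bg; rewrite (@pcompE _ _ _ (ispan f) s _ b g) //.
apply/pclassP; exists (idm C _); split; first by exists (idm C _); rewrite comp_idl.
by rewrite /= !comp_idl !comp_idr.
Qed.

Lemma pcomp_idr i j (x : phom i j) : pcomp x (pid i) = x.
Proof.
have [s ->] := pclass_ex x.
rewrite /pid (@pcomp_ispan _ _ _ s _ _ (leg s) (idm C _)).
  by rewrite comp_idr; case: (s).
apply: pullback_intro; first by rewrite comp_idl comp_idr.
by move=> t u v; rewrite comp_idl => ->; exists v; rewrite comp_idl.
Qed.

Lemma pcomp_assoc i j k l (z : phom k l) (y : phom j k) (x : phom i j) :
  pcomp z (pcomp y x) = pcomp (pcomp z y) x.
Proof.
have [s ->] := pclass_ex x; have [t ->] := pclass_ex y.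
have [r ->] := pclass_ex z.
have [p1 [b1 [g1 bg1]]] := mono_pullback_ex pb (arr s) (leg t).
have [p2 [b2 [g2 bg2]]] := mono_pullback_ex pb (arr t) (leg r).
have [p3 [b3 [g3 bg3]]] := mono_pullback_ex pb g1 b2.
rewrite (pcompE bg1) (pcompE bg2).
move: bg1 bg2 bg3 => [sq1 pb1] [sq2 pb2] [sq3 pb3].
rewrite (@pcompE _ _ _ (span_comp b1 g1) r _ b3 (g2 ∘ g3)); last first.
  apply: pullback_intro => /=.
    by rewrite -comp_assoc sq3 !comp_assoc sq2.
  move=> q u v; rewrite -comp_assoc => /pb2[w [[bw gw] _]].
  have [|w' [[bw' gw'] _]] := pb3 q u w; first by rewrite bw.
  by exists w'; rewrite -comp_assoc gw'.
rewrite (@pcompE _ _ _ s (span_comp b2 g2) _ (mono_comp b1 b3) g3); last first.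
  apply: pullback_intro => /=.
    by rewrite comp_assoc sq1 -!comp_assoc sq3.
  move=> q u v; rewrite -comp_assoc => /pb1[w [[bw gw] _]].
  have [w' [[bw' gw'] _]] := pb3 q w v gw.
  by exists w'; rewrite -comp_assoc bw'.
apply/pclassP; exists (idm C _); split; first by exists (idm C _); rewrite comp_idl.
by rewrite /= !comp_idr !comp_assoc.
Qed.

Definition partialization : category Ob :=
  Category pcomp_idl pcomp_idr pcomp_assoc.

End Partialization.

End CategoryNotions.

Section IteratedPartialization.
Variable Ob : Type.
Implicit Types C E : category Ob.

Lemma ispan_mono C (pb : condPB C) i j (a : mono C i j) :
  @is_mono _ (partialization pb) i j (pclass (ispan a)).
Proof.
have compE t (s : span C t i) : pcomp pb (pclass (ispan a)) (pclass s) =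
    pclass (Span (leg s) (a ∘ arr s)).
  rewrite (@pcompE _ _ pb _ _ _ s (ispan a) _ (mono_id _ _) (arr s)); last first.
    apply: pullback_intro => /=; first by rewrite comp_idl comp_idr.
    by move=> q u v; rewrite comp_idl => <-; exists u; rewrite comp_idl.
  apply/pclassP; exists (idm C _).
  split; first by exists (idm C _); rewrite comp_idl.
  by rewrite /= !comp_idr.
move=> t x y; have [s ->] := pclass_ex x; have [r ->] := pclass_ex y.
rewrite /= !compE => /pclassP[u [iso_u /= [lu au]]].
apply/pclassP; exists u; do 2!split=> //.
by apply: (mono_homP (m := a)); rewrite comp_assoc.
Qed.

(* A monomorphism a : i -> j of C seen as the monomorphism D(i, j, i, 1_i, a)
   of the partialization. *)
Definition pmono C (pb : condPB C) i j (a : mono C i j) :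
    mono (partialization pb) i j :=
  Mono (@ispan_mono C pb i j a).

(* iterate C n E: the n-fold partialization of C is defined and equal to E.
   Each step requires (PB) of the category reached so far, since composition
   in the partialization is defined by pullbacks along monomorphisms; (PB) and
   (CD) for C alone do not guarantee (PB) for its partialization, because the
   morphisms zeta tested in is_complement are only the monomorphisms. *)
Inductive iterate C : nat -> category Ob -> Type :=
| iterate0 : iterate C 0 C
| iterateS n E : iterate C n E ->
    forall pb : condPB E, iterate C n.+1 (partialization pb).

Fixpoint iter_mono C n E (T : iterate C n E) i j (a : mono C i j) : mono E i j :=
  match T in iterate _ n E return mono E i j with
  | iterate0 => a
  | iterateS _ _ T' pb => pmono pb (iter_mono T' a)
  end.

(* A diagram ... <-dleg 2- dob 2 <-dleg 1- dob 1 -darr-> j.  For a given n only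
   the objects dob r with 1 <= r <= n.+1 and the monomorphisms dleg r with
   1 <= r <= n are meaningful; the others are padding (a finite diagram can be
   padded with identities), and the source of the diagram is dob n.+1. *)
Record diagram C (j : Ob) : Type := Diagram {
  dob : nat -> Ob;
  dleg : forall r, mono C (dob r) (dob r.+1);
  darr : hom C (dob 1) j
}.

(* The morphism D(n, dob n.+1, j, dob r, dleg r, darr) of the n-fold
   partialization: the class of the span with left leg dleg n and right leg the
   morphism of the (n-1)-fold partialization given by the rest of d. *)
Fixpoint D C n E (T : iterate C n E) j (d : diagram C j) :
    hom E (dob d n.+1) j :=
  match T in iterate _ n E return hom E (dob d n.+1) j with
  | iterate0 => darr d
  | iterateS n' _ T' pb =>
      pclass (Span (iter_mono T' (dleg d n'.+1)) (D T' d))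
  end.

Section Product.
Variables (C : category Ob) (k : Ob) (y : diagram C k).

(* row r is the diagram formed by the objects p_r^s, the monomorphisms
   alpha_s^(r) and the morphism f^(r) : p_r^1 -> m_r, where m_r = dob y r;
   beta r s is beta_r^(s). *)
Definition product_steps (n : nat)
    (row : forall r, diagram C (dob y r))
    (beta : forall r s, mono C (dob (row r) s) (dob (row r.+1) s)) : Prop :=
  forall r, 1 <= r <= n ->
    is_pullback (darr (row r.+1)) (dleg y r) (beta r 1) (darr (row r)) /\
    (forall s, 1 <= s < r ->
      is_complement (beta r s) (dleg (row r.+1) s)
                    (dleg (row r) s) (beta r s.+1)).

(* The objects p_r^r, the monomorphisms alpha_r^(r+1) beta_r^(r) and the
   morphism g f^(1). *)
Definition product_diagram
    (row : forall r, diagram C (dob y r))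
    (beta : forall r s, mono C (dob (row r) s) (dob (row r.+1) s)) :
    diagram C k :=
  Diagram (dob := fun r => dob (row r) r)
    (fun r => mono_comp (dleg (row r.+1) r) (beta r r))
    (darr y ∘ darr (row 1)).

End Product.

End IteratedPartialization.

(* Main.v *)
Require Import Defs.
From mathcomp Require Import all_boot.
From mathcomp Require Import boolp.

(** Composing in a partialization means pulling back along a monomorphism, so
the theorem says how the pullback of an n-fold partial morphism along a
monomorphism of C is computed inside C.

The heart is one step, [pullback_partial]: in P(E), the pullback of the class
of i <-a- k -f-> j along a total monomorphism b is found by pulling f back
along b in E, which gives p -b'-> k, and then completing p -b'-> k -a-> i to a
complement diagram.  A direct check of the universal property would need
clause (b) of complement diagrams for arbitrary morphisms zeta, whereas it
is given for monomorphisms only.  The way around is that P(E) has pullbacks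
along monomorphisms as soon as one composes in its partialization: the
projection to i from such a pullback is a monomorphism, hence the class of a
monomorphism of E, so (b) applies to it and makes it factor through the
candidate.  Every cone over the square then factors through the candidate
too.

Iterating this step requires that complement diagrams of C stay complement
diagrams in every P^m(C) ([iter_mono_complement]).  This holds because the
monomorphisms of P(C) are the classes of the monomorphisms of C
([pmono_surj]) and because C -> P(C) preserves and reflects the pullbacks
concerned.  One row of the construction is thus a ladder of one pullback
followed by complement diagrams, and it yields the pullback in P^m(C)
([ladder_pullback]); the formula for the product follows by induction on n.
Existence of the rows is a recursive choice of pullbacks and complements. *)

Set Implicit Arguments.
Unset Strict Implicit.
Unset Printing Implicit Defensive.

Local Open Scope cat_scope.

(** * Pullbacks and monomorphisms *)

Section CategoryLemmas.
Variables (Ob : Type) (C : category Ob).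

Lemma mono_inj i j (a b : mono C i j) : mono_hom a = mono_hom b -> a = b.
Proof.
case: a b => [a Pa] [b Pb] /= eq_ab; case: b / eq_ab Pb => Pb.
by rewrite (Prop_irrelevance Pa Pb).
Qed.

Lemma mono_factor i j k (g : hom C j k) (f : hom C i j) :
  is_mono (g ∘ f) -> is_mono f.
Proof. by move=> gf_mono t u v fuv; apply: gf_mono; rewrite -!comp_assoc fuv. Qed.

Lemma pullback_sym i j k p (f : hom C i j) (a : hom C k j)
    (b : hom C p i) (g : hom C p k) :
  is_pullback f a b g -> is_pullback a f g b.
Proof.
move=> [fb pb]; split=> // t u v auv.
have [w [[bw gw] w_uniq]] := pb t v u (esym auv).
by exists w; split=> // w' [gw' bw']; apply: w_uniq.
Qed.

End CategoryLemmas.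

(** * Total morphisms in the partialization *)

Section TotalMorphisms.
Variables (Ob : Type) (C : category Ob) (pb : condPB C).
Local Notation P := (partialization pb).
Local Notation compP := (@Defs.comp _ P _ _ _).

Lemma span_iso_same_apex i j k (a : mono C k i) (b : mono C k i)
    (f g : hom C k j) :
  mono_hom a = b -> f = g -> span_iso (Span a f) (Span b g).
Proof. by move=> eq_ab ->; rewrite (mono_inj eq_ab); apply: span_iso_refl. Qed.

Lemma ispan_comp i j k (a : hom C j k) (s : span C i j) :
  compP (pclass (ispan a)) (pclass s) = pclass (Span (leg s) (a ∘ arr s)).
Proof.
rewrite /= (@pcompE _ _ pb _ _ _ s (ispan a) _ (mono_id _ _) (arr s)).
  by apply/pclassP; apply: span_iso_same_apex; rewrite //= comp_idr.
apply: pullback_intro => /=; first by rewrite comp_idl comp_idr.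
by move=> q u v; rewrite comp_idl => <-; exists u; rewrite comp_idl.
Qed.

Lemma ispan_inj i j (f g : hom C i j) :
  pclass (ispan f) = pclass (ispan g) -> f = g.
Proof.
move=> /pclassP[u [_ /= []]]; rewrite comp_idl => ->.
by rewrite comp_idr.
Qed.

Lemma ispan_functor i j k (g : hom C j k) (f : hom C i j) :
  compP (pclass (ispan g)) (pclass (ispan f)) = pclass (ispan (g ∘ f)).
Proof. exact: ispan_comp. Qed.

(** The idempotent span i <-a- k -a-> i is the partial identity on k, and
composing the class of (a, f) with it changes nothing; so if that class is a
monomorphism, the partial identity is the identity, that is, a is invertible. *)
Lemma mono_leg_iso i j (s : span C i j) :
  @is_mono _ P i j (pclass s) -> is_iso (leg s).
Proof.
move=> s_mono.
have /s_mono/pclassP : compP (pclass s) (pclass (Span (leg s) (leg s))) =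
    compP (pclass s) (idm P i).
  rewrite comp_idr /=.
  rewrite (@pcompE _ _ pb _ _ _ (Span (leg s) (leg s)) s _
             (mono_id C (apex s)) (idm C _)).
    case: s {s_mono} => k a f.
    by apply/pclassP; apply: span_iso_same_apex; rewrite /= comp_idr.
  apply: pullback_intro => //= t u v /(@mono_homP _ _ _ _ (leg s)) ->.
  by exists v; rewrite comp_idl.
move=> [u [u_iso /= []]]; rewrite comp_idl => <- _.
exact: u_iso.
Qed.

Lemma pmono_surj i j (x : mono P i j) : exists a, x = pmono pb a.
Proof.
case: x => x x_mono; have [[k a f] def_x] := pclass_ex x.
rewrite {}def_x in x_mono *.
have [v /= [va av]] := mono_leg_iso x_mono.
have eq_x : pclass (Span a f) = pclass (ispan (f ∘ v)).
  apply/pclassP; exists (mono_hom a); split; first by exists v.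
  by rewrite /= comp_idl -comp_assoc va comp_idr.
have fv_mono : is_mono (f ∘ v).
  move=> t u w fvuw; apply/ispan_inj/x_mono.
  by rewrite eq_x !ispan_functor fvuw.
by exists (Mono fv_mono); apply: mono_inj.
Qed.

Lemma pmono_comp i j k (b : mono C j k) (a : mono C i j) :
  pmono pb (mono_comp b a) = mono_comp (pmono pb b) (pmono pb a).
Proof. by apply: mono_inj; rewrite [RHS]ispan_functor. Qed.

(** Two equal classes (l, f u) and (m, a v) can be given the same left leg, and
then the mediating morphism is the one of C on the common apex. *)
Lemma ispan_pullback i j k p (f : hom C i j) (a : mono C k j)
    (b : mono C p i) (g : hom C p k) :
  is_pullback f a b g ->
  @is_pullback _ P _ _ _ _ (pclass (ispan f)) (pmono pb a) (pmono pb b)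
    (pclass (ispan g)).
Proof.
move=> [sq univ]; apply: pullback_intro.
  by rewrite !ispan_functor sq.
move=> t x y; have [u ->] := pclass_ex x; have [v ->] := pclass_ex y.
rewrite !ispan_comp => /pclassP[s [s_iso /= [ls av]]].
have [|w [[bw gw] _]] := univ _ (arr u) (arr v ∘ s).
  by rewrite -av comp_assoc.
exists (pclass (Span (leg u) w)); split; rewrite [LHS]ispan_comp /= ?bw ?gw.
  by case: (u).
by apply/pclassP; exists s.
Qed.

Lemma ispan_pullback_reflect i j k p (f : hom C i j) (a : mono C k j)
    (b : mono C p i) (g : hom C p k) :
  @is_pullback _ P _ _ _ _ (pclass (ispan f)) (pmono pb a) (pmono pb b)
    (pclass (ispan g)) ->
  is_pullback f a b g.
Proof.
move=> [sq univ].
have {}sq : f ∘ b = a ∘ g by apply: ispan_inj; rewrite -!ispan_functor.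
apply: pullback_intro => // t u v fu.
have [|x [[bx _] _]] := univ t (pclass (ispan u)) (pclass (ispan v)).
  by rewrite !ispan_functor fu.
have [w def_x] := pclass_ex x; move: bx; rewrite def_x ispan_comp.
(* b w is total up to the isomorphism s, so w itself is total. *)
move=> /pclassP[s [[s' [_ ss']] /= [_ us]]].
have bw : b ∘ (arr w ∘ s') = u.
  by rewrite comp_assoc -us -comp_assoc ss' comp_idr.
exists (arr w ∘ s'); split=> //.
by apply: (mono_homP (m := a)); rewrite comp_assoc -sq -comp_assoc bw.
Qed.

Lemma pmono_complement i j k l (a : mono C i j) (b : mono C j k)
    (c : mono C i l) (d : mono C l k) :
  is_complement a b c d ->
  is_complement (pmono pb a) (pmono pb b) (pmono pb c) (pmono pb d).
Proof.
move=> [pb_bd univ]; split; first exact: ispan_pullback.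
move=> m n xi eta zeta.
have [xi' ->] := pmono_surj xi; have [eta' ->] := pmono_surj eta.
have [zeta' ->] := pmono_surj zeta.
rewrite ispan_functor => /ispan_pullback_reflect/univ[phi [dphi phieta]].
by exists (pclass (ispan phi)); rewrite !ispan_functor dphi phieta.
Qed.

(** * Pullback of a partial morphism *)

(** The existence of some pullback L in P(E) is what makes this work: clause
(b) of the complement diagram concerns monomorphisms, and L -> i is one, so
L -> i factors through l' -> i.  Cones are then sent to L first. *)
Lemma pullback_partial (pbP : condPB P) i j k l p l'
    (f : hom C k j) (b : mono C l j) (a : mono C k i)
    (b1 : mono C p k) (f' : hom C p l) (a' : mono C p l') (b2 : mono C l' i) :
  is_pullback f b b1 f' -> is_complement b1 a a' b2 ->
  @is_pullback _ P _ _ _ _ (pclass (Span a f)) (pmono pb b) (pmono pb b2)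
    (pclass (Span a' f')).
Proof.
move=> pb_fb [pb_ab univ].
have sq : compP (pclass (Span a f)) (pmono pb b2) =
    compP (pmono pb b) (pclass (Span a' f')).
  rewrite ispan_comp /= (@pcomp_ispan _ _ pb _ _ _ (Span a f) _ _ a' b1).
    by rewrite /= pb_fb.1.
  exact: pullback_sym.
apply: pullback_intro => // t x y fxy.
have [L [B [G [sqL univL]]]] :=
  mono_pullback_ex pbP (pclass (Span a f)) (pmono pb b).
have [z def_B] := pmono_surj B; rewrite {B}def_B in sqL univL.
have [phi b2phi] : exists phi, b2 ∘ phi = z.
  (* The pullback of z along a is the test square of clause (b); its map u to k
     lands in p because b1 is the pullback of b along f. *)
  have [q [e [u pb_za]]] := mono_pullback_ex pb z a.
  have [g def_G] := pclass_ex G.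
  move: sqL; rewrite def_G ispan_comp /=.
  rewrite (@pcomp_ispan _ _ pb _ _ _ (Span a f) _ _ e u) //.
  move=> /pclassP[s [_ /= [_ bg]]].
  have [|w [[b1w _] _]] := pb_fb.2 q u (arr g ∘ s).
    by rewrite -bg comp_assoc.
  have w_mono : is_mono w.
    apply: (@mono_factor _ _ _ _ _ (a ∘ b1)).
    rewrite -comp_assoc b1w -pb_za.1; exact: is_mono_comp.
  have [|phi [b2phi _]] := univ _ _ (Mono w_mono) e z; last by exists phi.
  by rewrite /= b1w.
have [w [[zw _] _]] := univL t x y fxy.
exists (compP (pclass (ispan phi)) w).
have b2w : compP (pmono pb b2) (compP (pclass (ispan phi)) w) = x.
  by rewrite comp_assoc ispan_functor b2phi.
split=> //; apply: (mono_homP (m := pmono pb b)).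
by rewrite comp_assoc -sq -comp_assoc b2w.
Qed.

End TotalMorphisms.

(** * Ladders in the iterated partialization *)

Section Iteration.
Variables (Ob : Type) (C : category Ob).

Lemma iter_mono_comp n (E : category Ob) (T : iterate C n E) i j k
    (b : mono C j k) (a : mono C i j) :
  iter_mono T (mono_comp b a) = mono_comp (iter_mono T b) (iter_mono T a).
Proof.
elim: T => [|n' E' T' IH pb] //=.
by rewrite IH pmono_comp.
Qed.

Lemma iter_mono_complement n (E : category Ob) (T : iterate C n E) i j k l
    (a : mono C i j) (b : mono C j k) (c : mono C i l) (d : mono C l k) :
  is_complement a b c d ->
  is_complement (iter_mono T a) (iter_mono T b) (iter_mono T c) (iter_mono T d).
Proof.
move=> abcd; elim: T => [|n' E' T' IH pb] //=.
exact: pmono_complement.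
Qed.

(** Rows r and r.+1 of the construction form a ladder of length r.-1.  The
length is kept apart from the row number because it is the number of
partializations over which [ladder_pullback] inducts with b, d, d' fixed. *)
Definition is_ladder n j k (b : mono C k j) (d : diagram C j) (d' : diagram C k)
    (be : forall s, mono C (dob d' s) (dob d s)) : Prop :=
  is_pullback (darr d) b (be 1) (darr d') /\
  forall s, 1 <= s <= n -> is_complement (be s) (dleg d s) (dleg d' s) (be s.+1).

(** Each further partialization appends one complement diagram to the ladder:
the last leg of d and the pullback found so far are what [pullback_partial]
completes. *)
Lemma ladder_pullback n (E : category Ob) (T : iterate C n E) (pbE : condPB E)
    j k (b : mono C k j) (d : diagram C j) (d' : diagram C k)
    (be : forall s, mono C (dob d' s) (dob d s)) :
  is_ladder n b be ->
  is_pullback (D T d) (iter_mono T b) (iter_mono T (be n.+1)) (D T d').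
Proof.
elim: T pbE => [|n' E' T' IH pb] pbE [pb_d compl] //=.
apply: (pullback_partial pbE).
  apply: IH => //; split=> // s /andP[s_gt0 s_le].
  by apply: compl; rewrite s_gt0 leqW.
by apply: iter_mono_complement; apply: compl; rewrite leqnn.
Qed.

(** * The product formula *)

Lemma product_formula n (E : category Ob) (T : iterate C n E) k
    (y : diagram C k) (row : forall r, diagram C (dob y r))
    (beta : forall r s, mono C (dob (row r) s) (dob (row r.+1) s)) :
  product_steps n beta ->
  D T y ∘ D T (row n.+1) = D T (product_diagram beta).
Proof.
elim: T => [|n' E' T' IH pb] steps //=.
have ladder : is_ladder n' (dleg y n'.+1) (beta n'.+1).
  have [|pb_n compl] := steps n'.+1; [by rewrite leqnn | by split].
have pb_n := ladder_pullback T' pb ladder.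
rewrite (@pcompE _ _ pb _ _ _ (Span _ _) (Span _ _) _ _ _ pb_n).
apply/pclassP; apply: span_iso_same_apex; first by rewrite iter_mono_comp.
rewrite /= IH // => r /andP[r_gt0 r_le]; apply: steps.
by rewrite r_gt0 leqW.
Qed.

(** * Existence of the rows *)

Lemma ladder_ex j k (b : mono C k j) (d : diagram C j) : inS C ->
  exists (d' : diagram C k) (be : forall s, mono C (dob d' s) (dob d s)),
    forall n, is_ladder n b be.
Proof.
move=> [pbC cdC].
have [p [b1 [f' pb1]]] := mono_pullback_ex pbC (darr d) b.
have [p0 [b0 [g0 pb0]]] := mono_pullback_ex pbC (dleg d 0) b1.
have g0_mono : is_mono g0.
  by apply: (@mono_factor _ _ _ _ _ b1); rewrite -pb0.1; apply: is_mono_comp.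
pose state s := {q : Ob & mono C q (dob d s.+1)}.
have next s (st : state s) : {st' : state s.+1 & {c : mono C (tag st) (tag st') |
    is_complement (tagged st) (dleg d s.+1) c (tagged st')}}.
  have [l /cid[c /cid[e compl]]] := cid (cdC _ _ _ (tagged st) (dleg d s.+1)).
  by exists (existT _ l e), c.
pose st := fix st s : state s :=
  if s is s'.+1 then tag (next s' (st s')) else existT _ p b1.
(* Index 0 lies below the first square; it is filled by a pullback so that
   all vertical arrows are monomorphisms. *)
pose ob s := if s is s'.+1 then tag (st s') else p0.
pose lg s : mono C (ob s) (ob s.+1) :=
  if s is s'.+1 then tag (tagged (next s' (st s'))) else Mono g0_mono.
pose be s : mono C (ob s) (dob d s) :=
  if s is s'.+1 then tagged (st s') else b0.
exists (@Diagram _ C k ob lg f'), be => n; split=> // -[|s] // _.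
exact: (svalP (tagged (next s (st s)))).
Qed.

(** Below index n the rows are chosen by [ladder_ex]; above it they only pad,
and composing the arrow of x with the b r is enough.  The induction on n
shifts the sequence m by one, so that each new row is added at index 0 and the
dependent family row is extended by mere case analysis. *)
Lemma rows_ex (hC : inS C) n (m : nat -> Ob)
    (b : forall r, mono C (m r) (m r.+1)) (x : diagram C (m n)) :
  exists (row : forall r, diagram C (m r))
         (beta : forall r s, mono C (dob (row r) s) (dob (row r.+1) s)),
    row n = x /\ forall r, r < n -> forall l, is_ladder l (b r) (beta r).
Proof.
elim: n m b x => [|n IH] m b x.
  pose row := fix row r : diagram C (m r) :=
    if r is r'.+1 then Diagram (dleg (row r')) (b r' ∘ darr (row r')) else x.
  by exists row, (fun r s => mono_id C (dob (row r) s)).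
have [row [beta [row_n ladder]]] := IH (fun r => m r.+1) (fun r => b r.+1) x.
have [d [be d_ladder]] := ladder_ex (b 0) (row 0) hC.
pose row' r : diagram C (m r) := if r is r'.+1 then row r' else d.
pose beta' r : forall s, mono C (dob (row' r) s) (dob (row' r.+1) s) :=
  if r is r'.+1 then beta r' else be.
by exists row', beta'; split=> // -[|r] //; apply: ladder.
Qed.

End Iteration.

(* row n.+1 = x encodes p_{n+1}^s = l_s, p_{n+1}^{n+1} = i, f^(n+1) = f and
   alpha_s^(n+1) = alpha_s; D T (row n.+1) is then the morphism D T x.
   T says that E is the n-fold partialization of C. *)
Theorem proposition21 (Ob : Type) (C : category Ob) (hC : inS C)
    (n : nat) (hn : 1 <= n) (E : category Ob) (T : iterate C n E)
    (k : Ob) (y : diagram C k) (x : diagram C (dob y n.+1)) :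
  (exists (row : forall r, diagram C (dob y r))
          (beta : forall r s, mono C (dob (row r) s) (dob (row r.+1) s)),
     row n.+1 = x /\ product_steps n beta) /\
  (forall (row : forall r, diagram C (dob y r))
          (beta : forall r s, mono C (dob (row r) s) (dob (row r.+1) s)),
     row n.+1 = x -> product_steps n beta ->
     D T y ∘ D T (row n.+1) = D T (product_diagram beta)).
Proof.
split=> [|row beta _ steps]; last exact: product_formula.
have [row [beta [row_x ladder]]] := rows_ex hC (dleg y) x.
exists row, beta; split=> // -[|r] // r_le.
have [pb_r compl] := ladder r.+1 r_le r.
by split=> // s s_lt; apply: compl.
Qed.
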